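(* Let $\mathbb K$ be a field of characteristic $0$, let $R:=\mathbb K[x_1,\ldots,x_k]$, and let $\Sigma=(\underbrace{\ell_1,\ldots,\ell_1}_{m_1},\ldots,\underbrace{\ell_s,\ldots,\ell_s}_{m_s})$ be a collection of (nonzero) linear forms in $R$, where $\ell_i$ is repeated $m_i\ge 1$ times and $\gcd(\ell_i,\ell_j)=1$ if $i\neq j$. Denote $n=|\Sigma|=m_1+\cdots+m_s$ and let $1\leq a\leq n$. Then the ideal $I_a(\Sigma)$ has linear graded free resolution and the following primary decomposition: $$I_a(\Sigma)= \bigcap_{\mathfrak p\in \Gamma(\Sigma)}\mathfrak p^{\,a-n+\nu_{\Sigma}(\mathfrak p)}.$$
   Context: $R=\mathbb K[x_1,\ldots,x_k]$ has the standard grading. For a finite collection $\Sigma$ of $n$ linear forms, listed with repetition as $\lambda_1,\ldots,\lambda_n$ (some possibly proportional), and $1\le a\le n$, the ideal generated by all $a$-fold products of $\Sigma$ is $$I_a(\Sigma):=\langle \{\lambda_{i_1}\cdots \lambda_{i_a}\mid 1\leq i_1<\cdots<i_a\leq n\}\rangle\subset R.$$ $\Gamma(\Sigma)$ denotes the set of all prime ideals of $R$ that are generated by subsets of linear forms from $\Sigma$. For a prime ideal $\mathfrak p$ of $R$, $\nu_\Sigma(\mathfrak p)$ denotes the number of elements of $\Sigma$, counted with multiplicity, that belong to $\mathfrak p$. Convention: $\mathfrak p^{\,a-n+\nu_\Sigma(\mathfrak p)}$ is replaced by $R$ if $a-n+\nu_\Sigma(\mathfrak p)\le 0$. A homogeneous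 ideal $I\subset R$ generated in degree $d$ has linear (minimal) graded free resolution if there is a graded free resolution $$0\rightarrow R(-(d+b))^{n_{b+1}}\rightarrow\cdots\rightarrow R(-(d+1))^{n_2}\rightarrow R(-d)^{n_1}\rightarrow R \rightarrow R/I\rightarrow 0$$ for some integer $b\ge 0$, with integers $n_j\geq 1$. By convention the zero ideal has linear graded free resolution. *)

(* Defs.v *)
From mathcomp Require Import all_boot all_order all_algebra.
From mathcomp Require Import boolp classical_sets cardinality.
From mathcomp Require Import mpoly.

Set Implicit Arguments.
Unset Strict Implicit.
Unset Printing Implicit Defensive.

Import GRing.Theory.

Local Open Scope classical_set_scope.
Local Open Scope ring_scope.

Section Ideals.
Variable R : comUnitRingType.
Implicit Types (f g h : R) (S I P : set R) (G : set (set R)).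

Definition rdvd g f : Prop := exists h, f = h * g.

(* gcd(f, g) = 1: only units divide both *)
Definition rcoprime f g : Prop :=
  forall h, rdvd h f -> rdvd h g -> h \is a GRing.unit.

Definition ideal_gen S : set R :=
  [set f | exists r (c g : 'I_r -> R),
             (forall i, S (g i)) /\ f = \sum_i c i * g i].

(* The zeroth power is the whole ring, the empty product being 1. *)
Definition ideal_power I (e : nat) : set R :=
  ideal_gen [set f | exists g : 'I_e -> R,
                       (forall i, I (g i)) /\ f = \prod_i g i].

(* idealr_closed contains the requirement that 1 is not in the ideal *)
Definition prime_ideal I : Prop :=
  idealr_closed (mem I) /\ prime_idealr_closed (mem I).

Definition radical I : set R := [set f | exists m : nat, I (f ^+ m)].

Definition primary_ideal I : Prop :=
  idealr_closed (mem I) /\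
  forall f g, I (f * g) -> I f \/ radical I g.

(* I is the intersection of the Q P, for P in the finite set G, where each
   Q P is P-primary; components equal to the whole ring are tolerated, as
   they do not contribute to the intersection. *)
Definition primary_decomposition I G (Q : set R -> set R) : Prop :=
  [/\ finite_set G,
      forall P, G P ->
        Q P = setT \/ (primary_ideal (Q P) /\ radical (Q P) = P)
    & I = \bigcap_(P in G) Q P].

(* Index sets A of cardinality a stand for i_1 < ... < i_a. *)
Definition fold_products_ideal (a : nat) (Sigma : seq R) : set R :=
  ideal_gen [set f | exists A : {set 'I_(size Sigma)},
                       #|A| = a /\ f = \prod_(i in A) Sigma`_i].

Definition Gamma (Sigma : seq R) : set (set R) :=
  [set P | prime_ideal P /\
           exists2 S : set R, S `<=` [set` Sigma] & P = ideal_gen S].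

Definition nu (Sigma : seq R) P : nat := count (mem P) Sigma.

Definition collection s (m : 'I_s -> nat) (ell : 'I_s -> R) : seq R :=
  flatten [seq nseq (m i) (ell i) | i <- enum 'I_s].

End Ideals.

Section LinearResolution.
Variables (K : fieldType) (k : nat).
Local Notation R := {mpoly K[k]}.

(* A graded free resolution
     0 -> F_(b+1) -> ... -> F_2 -> F_1 -> R -> R/I -> 0
   with F_(j+1) = R(-(d+j))^(rk j), vectors being rows and maps acting by
   multiplication on the right: [gens] is the matrix of F_1 -> R and [phi j]
   that of F_(j+2) -> F_(j+1). A matrix is a graded map of degree 0 exactly
   when its entries are forms of degree the difference of the twists, i.e.,
   d for [gens] and 1 for [phi j]. Since [rk b.+1 = 0], exactness at F_(b+1)
   is injectivity of F_(b+1) -> F_b. Taking the images of the basis of F_1,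
   [lr_image] implies that I is generated by forms of degree d. *)
Record linear_resolution (I : set R) (d b : nat) (rk : nat -> nat)
    (gens : 'cV[R]_(rk 0%N))
    (phi : forall j : nat, 'M[R]_(rk j.+1, rk j)) : Prop := LinearResolution {
  lr_rank : forall j, (j <= b)%N -> (1 <= rk j)%N;
  lr_length : rk b.+1 = 0%N;
  lr_gens_homog : forall i, gens i 0 \is d.-homog;
  lr_phi_homog : forall j, (j < b)%N -> forall u v, phi j u v \is 1.-homog;
  lr_image : forall f, I f <-> exists v : 'rV[R]_(rk 0%N), f%:M = v *m gens;
  lr_exact0 : forall v : 'rV[R]_(rk 0%N),
    v *m gens = 0 <-> exists w, v = w *m phi 0%N;
  lr_exact : forall j, (j < b)%N -> forall v : 'rV[R]_(rk j.+1),
    v *m phi j = 0 <-> exists w, v = w *m phi j.+1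
}.

Definition has_linear_resolution (I : set R) : Prop :=
  I = [set 0] \/
  exists d b rk gens phi, @linear_resolution I d b rk gens phi.

End LinearResolution.

(* Main.v *)
Require Import Defs.
From mathcomp Require Import all_boot all_order all_algebra.
From mathcomp Require Import boolp classical_sets cardinality.
From mathcomp Require Import mpoly zify.

(** Both conclusions are proved by induction on the number of forms. Write s for
    a list of nonzero linear forms, I_a(s) for the ideal of its a-fold products,
    and J_a(s) for the intersection of the powers P^(a - c_P), where P runs over
    the ideals generated by members of s and c_P is the number of members of s
    outside P (so that a - c_P = a - n + nu(P)).

    Removing a form l from l :: s gives I_a(l :: s) = I_a(s) + l I_{a-1}(s).
    Let pr be a projection of the ring onto a polynomial subring which kills l
    and is congruent to the identity modulo l, and let t be the list of nonzero
    images under pr of the forms of s. Two facts drive the induction.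
    - The colon ideal (J_a(l :: s) : l) lies in J_{a-1}(s)
      ([power_intersection_colon]): dividing by l lowers by one the order along
      P if l is in P, and preserves it otherwise.
    - pr maps J_a(l :: s) into J_a(t) ([power_intersection_reduction]): for an
      ideal P generated by forms of t, the forms of l :: s that pr sends into P
      generate an ideal that pr also sends into P, and it misses at most as many
      forms of l :: s as P misses forms of t.
    If f is in J_a(l :: s), then pr f is in J_a(t) = I_a(t) by induction, so
    f = g + l h with g in I_a(s); then l h is in J_a(l :: s), h is in
    J_{a-1}(s) = I_{a-1}(s), and f is in I_a(l :: s). This is
    [fold_products_eq_intersection].

    The orders along P are controlled by [deformation]: for linear forms S
    there is a ring morphism phi from R to R[T] that multiplies the members of
    S by T and becomes the identity at T = 1; then f is in (S)^e exactly when
    T^e divides phi f. As R[T] is a domain, (S) is prime and its powers are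
    primary, which makes the equality I_a = J_a a primary decomposition.

    For the resolution, the same facts yield an exact sequence
      0 -> l I_{a-1}(s) -> I_a(l :: s) -> I_a(t) / l I_a(t) -> 0
    (l is a nonzerodivisor modulo I_a(t), since no ideal generated by forms of
    t contains l). The left term has a linear resolution by induction, the
    right one is resolved by the mapping cone of l on a linear resolution of
    I_a(t), and the horseshoe construction combines the two
    ([linearly_resolved_extension]); all the matrices involved can be chosen
    with linear entries. *)

Set Implicit Arguments.
Unset Strict Implicit.
Unset Printing Implicit Defensive.

Import GRing.Theory.

Local Open Scope classical_set_scope.
Local Open Scope ring_scope.

(** * Ideals and their powers *)

Section Ideals.
Variable R : comUnitRingType.
Implicit Types (f g h : R) (I J S : set R).

(** Unlike [idealr_closed], this allows the whole ring, which occurs as the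
    power of exponent 0. *)
Definition is_ideal J : Prop :=
  [/\ J 0, forall f g, J f -> J g -> J (f + g) & forall c f, J f -> J (c * f)].

Lemma is_ideal_sum J n (F : 'I_n -> R) :
  is_ideal J -> (forall i, J (F i)) -> J (\sum_i F i).
Proof. by case=> J0 JD _ JF; apply: big_ind. Qed.

Lemma is_ideal_opp J f : is_ideal J -> J f -> J (- f).
Proof. by case=> _ _ JM /(JM (-1)); rewrite mulN1r. Qed.

Lemma is_ideal_sub J f g : is_ideal J -> J f -> J g -> J (f - g).
Proof.
by move=> idJ Jf /(is_ideal_opp idJ) Jg; case: idJ => _ JD _; apply: JD.
Qed.

Lemma ideal_gen_sub S : S `<=` ideal_gen S.
Proof.
move=> f Sf; exists 1%N, (fun=> 1), (fun=> f); split=> //.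
by rewrite big_ord1 mul1r.
Qed.

Lemma ideal_gen_ideal S : is_ideal (ideal_gen S).
Proof.
split=> [|f g|c f].
- exists 0%N, (fun=> 0), (fun=> 0); split; first by case.
  by rewrite big_ord0.
- move=> [r [c [p [Sp ->]]]] [r' [c' [p' [Sp' ->]]]].
  pose glue (u : 'I_r -> R) (u' : 'I_r' -> R) (i : 'I_(r + r')) :=
    match split i with inl j => u j | inr j => u' j end.
  exists (r + r')%N, (glue c c'), (glue p p'); split.
    by move=> i; rewrite /glue; case: splitP.
  rewrite big_split_ord /=; congr (_ + _); apply: eq_bigr => i _.
    by rewrite /glue -[lshift _ _]/(unsplit (inl i)) unsplitK.
  by rewrite /glue -[rshift _ _]/(unsplit (inr i)) unsplitK.
- move=> [r [d [p [Sp ->]]]]; exists r, (fun i => c * d i), p; split=> //.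
  by rewrite mulr_sumr; apply: eq_bigr => i _; rewrite mulrA.
Qed.

Lemma ideal_gen_min S J : is_ideal J -> S `<=` J -> ideal_gen S `<=` J.
Proof.
move=> idJ SJ f [r [c [p [Sp ->]]]]; apply: is_ideal_sum => // i.
by case: idJ => _ _; apply; apply: SJ.
Qed.

Lemma ideal_gen_mono S S' : S `<=` S' -> ideal_gen S `<=` ideal_gen S'.
Proof.
move=> SS'; apply: ideal_gen_min; first exact: ideal_gen_ideal.
by move=> f /SS'; apply: ideal_gen_sub.
Qed.

Lemma is_ideal_preim (psi : {rmorphism R -> R}) J :
  is_ideal J -> is_ideal (psi @^-1` J).
Proof.
case=> J0 JD JM; split=> /= [|f g|c f]; rewrite ?rmorph0 ?rmorphD ?rmorphM //.
  exact: JD.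
exact: JM.
Qed.

Lemma ideal_power_ideal I e : is_ideal (ideal_power I e).
Proof. exact: ideal_gen_ideal. Qed.

Lemma ideal_power0 I f : ideal_power I 0 f.
Proof.
have [_ _ pM] := ideal_power_ideal I 0.
rewrite -[f]mulr1; apply: pM; apply: ideal_gen_sub.
by exists (fun=> 0); split; [case | rewrite big_ord0].
Qed.

Lemma ideal_power1 I f : I f -> ideal_power I 1 f.
Proof.
by move=> If; apply: ideal_gen_sub; exists (fun=> f); rewrite big_ord1.
Qed.

Lemma ideal_powerM I i j f g :
  ideal_power I i f -> ideal_power I j g -> ideal_power I (i + j) (f * g).
Proof.
move=> If Ig; have [p0 pD pM] := ideal_power_ideal I (i + j).
have idl h : is_ideal [set u | ideal_power I (i + j) (u * h)].
  split=> /= [|u v|c u]; first by rewrite mul0r.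
    by rewrite mulrDl; apply: pD.
  by rewrite -mulrA; apply: pM.
apply: (ideal_gen_min (idl g) _ If) => _ [u [Iu ->]] /=; rewrite mulrC.
apply: (ideal_gen_min (idl _) _ Ig) => _ [v [Iv ->]] /=; rewrite mulrC.
apply: ideal_gen_sub.
exists (fun n => match split n with inl n1 => u n1 | inr n2 => v n2 end).
split; first by move=> n; case: splitP.
rewrite big_split_ord /=; congr (_ * _); apply: eq_bigr => n _.
  by rewrite -[lshift _ _]/(unsplit (inl n)) unsplitK.
by rewrite -[rshift _ _]/(unsplit (inr n)) unsplitK.
Qed.

Lemma ideal_power_leq I e e' :
  (e <= e')%N -> ideal_power I e' `<=` ideal_power I e.
Proof.
move=> le_e; apply: ideal_gen_min; first exact: ideal_power_ideal.
rewrite -(subnK le_e) => _ [u [Iu ->]]; rewrite big_split_ord /=.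
have [_ _ pM] := ideal_power_ideal I e; apply: pM; apply: ideal_gen_sub.
by exists (fun n => u (rshift _ n)).
Qed.

Lemma ideal_power_sub I e : is_ideal I -> (0 < e)%N -> ideal_power I e `<=` I.
Proof.
case: e => // e idI _; apply: ideal_gen_min => // _ [u [Iu ->]].
by rewrite big_ord_recl mulrC; case: idI => _ _; apply.
Qed.

Lemma ideal_power_map (psi : {rmorphism R -> R}) I J e f :
    (forall g, I g -> J (psi g)) ->
  ideal_power I e f -> ideal_power J e (psi f).
Proof.
move=> IJ; have := is_ideal_preim psi (ideal_power_ideal J e).
move=> idp; apply: (ideal_gen_min idp) => _ [u [Iu ->]] /=.
rewrite /preimage /= rmorph_prod; apply: ideal_gen_sub.
by exists (fun n => psi (u n)); split=> // n; apply: IJ.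
Qed.

Lemma ideal_gen_map (psi : {rmorphism R -> R}) S J f :
    is_ideal J -> (forall g, S g -> J (psi g)) -> ideal_gen S f -> J (psi f).
Proof.
move=> idJ SJ Sf.
exact: (ideal_gen_min (is_ideal_preim psi idJ) SJ Sf).
Qed.

End Ideals.

(** * Powers of ideals generated by linear forms *)

Section Deformation.
Variables (K : fieldType) (k : nat).
Local Notation R := {mpoly K[k]}.
Implicit Types (f g h : R) (S T : seq R).

Definition ideal_of S : set R := ideal_gen [set` S].

(** Membership in the Rees algebra of I, the sum of the I^i T^i. *)
Definition coef_in_powers (I : set R) (p : {poly R}) : Prop :=
  forall i, ideal_power I i p`_i.

Lemma coef_in_powersM I p q :
  coef_in_powers I p -> coef_in_powers I q -> coef_in_powers I (p * q).
Proof.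
move=> Ip Iq i; rewrite coefM; apply: is_ideal_sum => [|j].
  exact: ideal_power_ideal.
by rewrite -[i in ideal_power _ i](subnKC (leq_ord j)); apply: ideal_powerM.
Qed.

Lemma coef_in_powersD I p q :
  coef_in_powers I p -> coef_in_powers I q -> coef_in_powers I (p + q).
Proof.
move=> Ip Iq i; rewrite coefD.
by have [_ pD _] := ideal_power_ideal I i; apply: pD.
Qed.

Lemma coef_in_powersC (I : set R) f : coef_in_powers I f%:P.
Proof.
case=> [|i]; first exact: ideal_power0.
by rewrite coefC; have [] := ideal_power_ideal I i.+1.
Qed.

Lemma linear_formE f : f \is 1.-homog -> f = \sum_j f@_U_(j) *: 'X_j.
Proof.
move=> /dhomogP f1; apply/mpolyP => m; rewrite raddf_sum /=.
under eq_bigr do rewrite mcoeffZ mcoeffX.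
have [/mdeg1P[i /eqP->]|m1] := boolP (mdeg m == 1%N).
  rewrite (bigD1 i) //= eqxx mulr1 big1 ?addr0 // => j ji.
  by rewrite eq_mnm1 (negbTE ji) mulr0.
rewrite big1 => [|j _].
  by apply/eqP; rewrite mcoeff_eq0; apply: contra m1 => /f1 /eqP.
by case: (_ =P m) m1 => [<-|]; rewrite ?mdeg1 ?mulr0.
Qed.

(** A property of polynomials stable under sums and products need only be
    checked on constants and variables, which suits ring morphisms. *)
Lemma mpoly_subring_ind (P : R -> Prop) :
    (forall c, P c%:MP) -> (forall j, P 'X_j) ->
    (forall f g, P f -> P g -> P (f + g)) ->
    (forall f g, P f -> P g -> P (f * g)) ->
  forall f, P f.
Proof.
move=> PC PX PD PM f.
have P1 : P 1 by rewrite -mpolyC1; apply: PC.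
have PXn j n : P ('X_j ^+ n).
  by elim: n => [|n Pn]; rewrite ?expr0 // exprS; apply: PM.
elim/mpolyind: f => [|c u p _ _ Pp]; first by rewrite -mpolyC0; apply: PC.
apply: PD => //; rewrite -mul_mpolyC; apply: (PM) => //.
by rewrite mpolyXE_id; apply: big_ind.
Qed.

(** For every ideal generated by linear forms there is a linear projection
    killing exactly its linear forms; phi moves each variable along the line
    from its projection (T = 0) to itself (T = 1). The parameter T thus records
    the order of vanishing along S, and the constant term of phi is the
    projection. *)
Lemma deformation S : all (fun g => g \is 1.-homog) S ->
  exists2 phi : {rmorphism R -> {poly R}},
    forall c, phi c%:MP = c%:MP%:P &
    [/\ forall f, (phi f).[1] = f,
        forall f, coef_in_powers (ideal_of S) (phi f),
        {in S, forall g, phi g = g *: 'X},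
        forall f, f \is 1.-homog -> (phi f)`_0 \is 1.-homog
      & forall f, phi (phi f)`_0 = ((phi f)`_0)%:P].
Proof.
move=> /allP S1.
pose U := \matrix_(i < size S, j < k) (S`_i)@_U_(j).
(* Since v *m pinvmx U *m U = v on the row space of U, [l j] is the component
   of 'X_j along S for a projection onto the linear span of S. *)
pose l j := \sum_i pinvmx U j i *: S`_i.
pose h j := ('X_j - l j)%:P + l j *: 'X : {poly R}.
have [phi phiX phiC] : exists2 phi : {rmorphism R -> {poly R}},
    (forall j, phi 'X_j = h j) & forall c, phi c%:MP = c%:MP%:P.
  exists (mmap (polyC \o @mpolyC k K) h) => [j|c]; last exact: mmapC.
  by rewrite /= mmapX mmap1U.
have Sl j : ideal_of S (l j).
  apply: is_ideal_sum => [|i]; first exact: ideal_gen_ideal.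
  have [_ _ SM] := ideal_gen_ideal [set` S]; rewrite -mul_mpolyC; apply: SM.
  by apply: ideal_gen_sub; rewrite /= mem_nth.
have l1 j : l j \is 1.-homog.
  by apply: rpred_sum => i _; apply: dhomogZ; apply: S1; rewrite mem_nth.
have phi_lin g : g \is 1.-homog ->
    let g' := \sum_j g@_U_(j) *: l j in phi g = (g - g')%:P + g' *: 'X.
  move=> g1 /=; rewrite {1 2}[g]linear_formE // -sumrB !rmorph_sum scaler_suml.
  rewrite -big_split /=; apply: eq_bigr => j _.
  rewrite -!mul_mpolyC rmorphM phiC phiX /h mulrDr.
  by rewrite -polyCM mulrBr mul_polyC scalerA.
have tail j : coef_in_powers (ideal_of S) (l j *: 'X).
  move=> i; rewrite coefZ coefX; case: eqP => [->|_].
    by rewrite mulr1; apply: ideal_power1.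
  by rewrite mulr0; have [] := ideal_power_ideal (ideal_of S) i.
have phiS : {in S, forall g, phi g = g *: 'X}.
  move=> g Sg; rewrite (phi_lin _ (S1 _ Sg)).
  suff -> : \sum_j g@_U_(j) *: l j = g by rewrite subrr add0r.
  pose v := \row_j g@_U_(j); pose i0 := Ordinal (etrans (index_mem _ _) Sg).
  have vU : v *m pinvmx U *m U = v.
    apply: mulmxKpV; rewrite (_ : v = row i0 U) ?row_sub //.
    by apply/rowP => j; rewrite !mxE /= nth_index.
  transitivity (\sum_i (v *m pinvmx U) 0 i *: S`_i).
    under eq_bigr do rewrite scaler_sumr.
    rewrite exchange_big; apply: eq_bigr => i _; rewrite mxE scaler_suml.
    by apply: eq_bigr => j _; rewrite scalerA [v _ _]mxE.
  rewrite [RHS]linear_formE ?S1 //.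
  transitivity (\sum_j (v *m pinvmx U *m U) 0 j *: ('X_j : R)).
    under [RHS]eq_bigr do rewrite mxE scaler_suml.
    rewrite exchange_big; apply: eq_bigr => i _.
    rewrite [S`_i]linear_formE ?S1 ?mem_nth // scaler_sumr.
    by apply: eq_bigr => j _; rewrite scalerA [U _ _]mxE.
  by rewrite vU; apply: eq_bigr => j _; rewrite mxE.
have phil j : phi (l j) = l j *: 'X.
  rewrite /l rmorph_sum scaler_suml; apply: eq_bigr => i _.
  rewrite -mul_mpolyC rmorphM phiC phiS ?mem_nth //.
  by rewrite -!mul_polyC polyCM mulrA.
exists phi => //; split=> //.
- apply: mpoly_subring_ind => [c|j|f g phif phig|f g phif phig].
  + by rewrite phiC hornerC.
  + by rewrite phiX /h hornerD hornerC hornerZ hornerX mulr1 subrK.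
  + by rewrite rmorphD hornerD phif phig.
  + by rewrite rmorphM hornerM phif phig.
- apply: mpoly_subring_ind => [c|j|f g phif phig|f g phif phig].
  + by rewrite phiC; apply: coef_in_powersC.
  + by rewrite phiX; apply: coef_in_powersD => //; apply: coef_in_powersC.
  + by rewrite rmorphD; apply: coef_in_powersD.
  + by rewrite rmorphM; apply: coef_in_powersM.
- move=> f f1; rewrite phi_lin // coefD coefC coefZ coefX mulr0 addr0.
  apply: rpredB => //; apply: rpred_sum => j _; exact: dhomogZ.
- apply: mpoly_subring_ind => [c|j|f g phif phig|f g phif phig].
  + by rewrite phiC coefC phiC.
  + rewrite phiX /h coefD coefC coefZ coefX mulr0 addr0 rmorphB phiX phil.
    by rewrite addrK.
  + by rewrite rmorphD coefD rmorphD phif phig polyCD.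
  + by rewrite rmorphM coef0M rmorphM phif phig polyCM.
Qed.
End Deformation.

(** Multiplicativity of the T-adic order, when one factor has order 0. *)
Lemma dvdXn_mul (R : idomainType) (p q r : {poly R}) e :
  p * q = r * 'X^e -> q`_0 != 0 -> exists p', p = p' * 'X^e.
Proof.
move=> pq q0; elim: e p r pq => [|e IH] p r pq.
  by exists p; rewrite expr0 mulr1.
have /factor_theorem[p1 def_p] : root p 0.
  rewrite rootE horner_coef0 -(mulIr_eq0 _ (mulIf q0)) -coef0M pq.
  by rewrite exprSr mulrA coefMX.
rewrite subr0 in def_p.
have [|p' Ep1] := IH p1 r.
  apply: (mulIf (negbT (polyX_eq0 R))).
  by rewrite mulrAC -def_p pq exprSr mulrA.
by exists p'; rewrite def_p Ep1 exprSr mulrA.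
Qed.

Section Powers.
Variables (K : fieldType) (k : nat).
Local Notation R := {mpoly K[k]}.
Implicit Types (f g h : R) (S T : seq R).

Lemma ideal_of_ideal S : is_ideal (ideal_of S).
Proof. exact: ideal_gen_ideal. Qed.

Lemma ideal_of_sub S f : f \in S -> ideal_of S f.
Proof. by move=> Sf; apply: ideal_gen_sub. Qed.

(** If phi f = q T^e, evaluation at T = 1 writes f as the sum of the
    coefficients of phi f, all of index at least e, hence all in (S)^e. *)
Lemma order_filtration S : all (fun g => g \is 1.-homog) S ->
  exists phi : {rmorphism R -> {poly R}},
    {in S, forall g, phi g = g *: 'X} /\
    forall e f, ideal_power (ideal_of S) e f <-> exists q, phi f = q * 'X^e.
Proof.
case/deformation=> phi _ [phi1 phiI phiS _ _]; exists phi; split=> // e f.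
have idX n : is_ideal [set g | exists q, phi g = q * 'X^n].
  split=> [|g h [p Ep] [q Eq]|c g [q Eq]] /=.
  - by exists 0; rewrite rmorph0 mul0r.
  - by exists (p + q); rewrite rmorphD Ep Eq mulrDl.
  - by exists (phi c * q); rewrite rmorphM Eq mulrA.
split=> [Pf|[q Eq]].
  apply: (ideal_gen_min (idX e) _ Pf) => _ [u [Iu ->]] /=.
  have /choice[q uX] i : exists q, phi (u i) = q * 'X^1.
    apply: (ideal_gen_min (idX 1) _ (Iu i)) => g /= Sg.
    by exists g%:P; rewrite phiS // mul_polyC.
  exists (\prod_i q i).
  rewrite rmorph_prod -['X^e](_ : \prod_(i < e) 'X = _); last first.
    by rewrite prodr_const card_ord.
  rewrite -big_split /=; apply: eq_bigr => i _; exact: uX.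
rewrite -[f]phi1 horner_coef; apply: is_ideal_sum => [|i].
  exact: ideal_power_ideal.
rewrite expr1n mulr1; have [lt_ie|le_ei] := ltnP i e; last first.
  exact: ideal_power_leq le_ei _ (phiI f i).
rewrite (congr1 (fun p : {poly R} => p`_i) Eq) coefMXn lt_ie.
by have [] := ideal_power_ideal (ideal_of S) e.
Qed.

Section LinearPrime.
Variable S : seq R.
Hypothesis S1 : all (fun g => g \is 1.-homog) S.

(** A generator has order exactly one along the ideal: phi l = l T, where the
    constant l is prime to T. *)
Lemma ideal_power_cancel l e f : l \in S -> l != 0 ->
  ideal_power (ideal_of S) e (l * f) -> ideal_power (ideal_of S) e.-1 f.
Proof.
have [phi [phiS powP]] := order_filtration S1.
move=> Sl l0; rewrite !powP rmorphM phiS //; case: e => [_|e [q]] /=.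
  by exists (phi f); rewrite mulr1.
rewrite exprSr mulrA -scalerAl [_ * phi f]mulrC scalerAl.
move/(mulIf (negbT (polyX_eq0 _))); rewrite -mul_polyC mulrC.
by move/dvdXn_mul; apply; rewrite coefC.
Qed.

(** An element outside (S) has order 0, so it cannot contribute to the order of
    a product. *)
Lemma ideal_power_primary e f g :
  ideal_power (ideal_of S) e (f * g) ->
  ideal_power (ideal_of S) e f \/ ideal_of S g.
Proof.
have [phi [phiS powP]] := order_filtration S1.
have [g0|g0] := eqVneq (phi g)`_0 0.
  right; apply: (@ideal_power_sub _ _ 1) => //; first exact: ideal_of_ideal.
  have /factor_theorem[q Eq] : root (phi g) 0 by rewrite rootE horner_coef0 g0.
  by apply/powP; exists q; rewrite Eq subr0.
by rewrite powP rmorphM => -[q /dvdXn_mul Eq]; left; apply/powP/Eq.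
Qed.

Lemma ideal_of_primeM f g :
  ideal_of S (f * g) -> ideal_of S f \/ ideal_of S g.
Proof.
case/ideal_power1/ideal_power_primary; last by right.
by move/(ideal_power_sub (ideal_of_ideal S) (ltn0Sn 0)); left.
Qed.

Lemma ideal_of_proper : ~ ideal_of S 1.
Proof.
have [phi [phiS powP]] := order_filtration S1.
move=> /ideal_power1/powP[q]; rewrite rmorph1.
move/(congr1 (fun p : {poly R} => p`_0)).
by rewrite coefMXn /= coef1 => /eqP; rewrite oner_eq0.
Qed.

Lemma ideal_power_proper e : (0 < e)%N -> ~ ideal_power (ideal_of S) e 1.
Proof.
by move=> e0 /(ideal_power_sub (ideal_of_ideal S) e0); apply: ideal_of_proper.
Qed.

Lemma ideal_of_prime : prime_ideal (ideal_of S).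
Proof.
have [S0 SD SM] := ideal_of_ideal S.
split; last first.
  move=> f g /set_mem/ideal_of_primeM[] Sfg; apply/orP.
    by left; apply/mem_set.
  by right; apply/mem_set.
split; first by apply/mem_set.
  by apply/negP => /set_mem /ideal_of_proper.
move=> a f g /set_mem Sf /set_mem Sg; apply/mem_set.
by apply: SD => //; apply: SM.
Qed.

Lemma radical_power e :
  (0 < e)%N -> radical (ideal_power (ideal_of S) e) = ideal_of S.
Proof.
move=> e0; apply/seteqP; split=> f /=; last first.
  move=> Sf; exists e; apply: ideal_gen_sub; exists (fun=> f); split=> //.
  by rewrite prodr_const card_ord.
case=> m /(ideal_power_sub (ideal_of_ideal S) e0).
elim: m => [/ideal_of_proper//|m IH].
by rewrite exprS => /ideal_of_primeM[].
Qed.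

Lemma ideal_power_is_primary e :
  (0 < e)%N -> primary_ideal (ideal_power (ideal_of S) e).
Proof.
move=> e0; have [S0 SD SM] := ideal_power_ideal (ideal_of S) e.
split; last first.
  move=> f g /ideal_power_primary[]; first by left.
  by rewrite radical_power //; right.
split; first by apply/mem_set.
  by apply/negP => /set_mem /(ideal_power_proper e0).
move=> a f g /set_mem Sf /set_mem Sg; apply/mem_set.
by apply: SD => //; apply: SM.
Qed.

End LinearPrime.
End Powers.

(** * Ideals of fold products and intersections of powers *)

Section Products.
Variable R : comUnitRingType.
Implicit Types (s : seq R) (a : nat).

(** The recursion chooses whether the first form enters the product; all proofs
    by induction on the forms follow it. *)
Fixpoint fold_products s a : seq R :=
  match s, a with
  | _, 0 => [:: 1]
  | [::], _.+1 => [::]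
  | x :: s', a'.+1 => fold_products s' a ++ map ( *%R x) (fold_products s' a')
  end.

Lemma fold_products0 s : fold_products s 0 = [:: 1].
Proof. by case: s. Qed.

(** Boolean masks bridge the recursion and the subsets of indices: they can be
    split at the head like lists, and are the characteristic sequences of
    subsets. *)
Lemma fold_products_maskP s a f :
  f \in fold_products s a <->
  exists b, [/\ size b = size s, count id b = a & f = \prod_(x <- mask b s) x].
Proof.
elim: s a f => [|x s IH] [|a] f /=; rewrite ?inE.
- split=> [/eqP->|[b [/size0nil-> _ ->]]]; last by rewrite big_nil.
  by exists [::]; rewrite big_nil.
- by split=> // -[b [/size0nil->]].
- split=> [/eqP->|[[|b0 b] [//= [sb] cb ->]]].
    exists (nseq (size s).+1 false); split; rewrite ?size_nseq ?count_nseq //.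
    by rewrite mask_false big_nil.
  case: b0 cb => //= cb; rewrite add0n in cb.
  have := IH 0%N (\prod_(y <- mask b s) y); rewrite fold_products0 inE => -[_].
  by apply; exists b.
rewrite mem_cat.
split=> [/orP[/IH[b [sb cb ->]]|/mapP[g /IH[b [sb cb ->]] ->]]|].
- by exists (false :: b); rewrite /= sb cb.
- by exists (true :: b); rewrite /= sb cb big_cons.
case=> -[|[] b] [//= [sb] [cb] ->]; apply/orP; [right|left].
  rewrite big_cons; apply/mapP; exists (\prod_(y <- mask b s) y) => //.
  by apply/IH; exists b.
by apply/IH; exists b.
Qed.

Lemma fold_productsP s a f :
  f \in fold_products s a <->
  exists A : {set 'I_(size s)}, #|A| = a /\ f = \prod_(i in A) s`_i.
Proof.
pose set_of b := [set i : 'I_(size s) | nth false b i]%SET.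
have prodE b : \prod_(x <- mask b s) x = \prod_(i in set_of b) s`_i.
  rewrite big_mask /=; apply: eq_big => i; first by rewrite inE andbT.
  by rewrite (tnth_nth 0).
have cardE b : size b = size s -> #|set_of b| = count id b.
  move=> sb; rewrite -(size_mask sb) -[RHS]sum1_size big_mask -sum1_card.
  by apply: eq_bigl => i; rewrite inE andbT.
rewrite fold_products_maskP; split=> [[b [sb cb ->]]|[A [cA ->]]].
  by exists (set_of b); rewrite cardE // -prodE.
pose b := [seq i \in A | i <- enum 'I_(size s)].
have sb : size b = size s by rewrite size_map size_enum_ord.
have bA : set_of b = A.
  apply/setP => i; rewrite inE (nth_map i) ?size_enum_ord //.
  by rewrite nth_ord_enum.
by exists b; rewrite prodE -cardE // bA.
Qed.

Lemma fold_products_idealE a s :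
  fold_products_ideal a s = ideal_gen [set` fold_products s a].
Proof.
congr ideal_gen; apply/seteqP.
by split=> f /fold_productsP.
Qed.

Lemma fold_products_filter p s a :
  {subset fold_products (filter p s) a <= fold_products s a}.
Proof.
elim: s a => [|x s IH] [|a] f //=; first by rewrite fold_products0.
rewrite mem_cat; case: (p x) => /= [|/IH->//].
rewrite mem_cat => /orP[/IH->//|/mapP[g /IH Sg ->]].
by rewrite (map_f _ Sg) orbT.
Qed.

Lemma fold_products_map (psi : {rmorphism R -> R}) s a :
  fold_products (map psi s) a = map psi (fold_products s a).
Proof.
elim: s a => [|x s IH] [|a] //=; rewrite ?rmorph1 // !IH map_cat -!map_comp.
by congr (_ ++ _); apply: eq_map => f /=; rewrite rmorphM.
Qed.

End Products.

Section Decomposition.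
Variables (K : fieldType) (k : nat).
Local Notation R := {mpoly K[k]}.
Implicit Types (f g h l : R) (s S T : seq R) (P : set R).

Definition linear_form f := (f \is 1.-homog) && (f != 0).

Lemma fold_products_homog s d : all linear_form s ->
  {in fold_products s d, forall f, f \is d.-homog}.
Proof.
elim: s d => [|x s IH] [|d] //= lin_s f; rewrite ?inE.
- by move/eqP->; apply: dhomog1.
- by move/eqP->; apply: dhomog1.
case/andP: lin_s => /andP[x1 _] lin_s; rewrite mem_cat.
case/orP=> [/IH->//|/mapP[g /IH g_d ->]].
by rewrite -add1n; apply: dhomogM => //; apply: g_d.
Qed.

Lemma ideal_of_fold_cons l s a f :
  ideal_of (fold_products (l :: s) a.+1) f <->
  exists g h, [/\ ideal_of (fold_products s a.+1) g,
                  ideal_of (fold_products s a) h & f = g + l * h].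
Proof.
have [I0 ID IM] := ideal_of_ideal (fold_products (l :: s) a.+1).
have [g0 gD gM] := ideal_of_ideal (fold_products s a.+1).
have [h0 hD hM] := ideal_of_ideal (fold_products s a).
have idJ : is_ideal [set f | exists g h, [/\ ideal_of (fold_products s a.+1) g,
                           ideal_of (fold_products s a) h & f = g + l * h]].
  split=> [|_ _ [g [h [Ig Ih ->]]] [g' [h' [Ig' Ih' ->]]]|
            c _ [g [h [Ig Ih ->]]]].
  - by exists 0, 0; rewrite mulr0 addr0.
  - exists (g + g'), (h + h'); rewrite mulrDr addrACA.
    by split=> //; [apply: gD | apply: hD].
  - exists (c * g), (c * h); rewrite mulrDr mulrCA.
    by split=> //; [apply: gM | apply: hM].
split=> [If|[g [h [Ig Ih ->]]]].
  apply: (ideal_gen_min idJ _ If) => {If}f /=.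
  rewrite mem_cat => /orP[Sf|/mapP[h Sh ->]].
    by exists f, 0; rewrite mulr0 addr0; split=> //; apply: ideal_of_sub.
  by exists 0, h; rewrite add0r; split=> //; apply: ideal_of_sub.
apply: (ID).
  apply: (ideal_gen_mono _ Ig) => u /= Su.
  by rewrite mem_cat Su.
have idl : is_ideal [set u | ideal_of (fold_products (l :: s) a.+1) (l * u)].
  split=> /= [|u v|c u]; first by rewrite mulr0.
    by rewrite mulrDr; apply: ID.
  by rewrite mulrCA; apply: IM.
apply: (ideal_gen_min idl _ Ih) => u /= Su; apply: ideal_of_sub.
by rewrite mem_cat (map_f _ Su) orbT.
Qed.

(** Counting the forms outside P rather than inside turns the exponent
    a - n + nu(P) into a - nonmembers P s, whose truncated difference gives
    exactly the convention for nonpositive exponents. *)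
Definition nonmembers P s : nat := count (fun x => x \notin P) s.

Definition power_intersection s a : set R :=
  [set f | forall T, {subset T <= s} ->
           ideal_power (ideal_of T) (a - nonmembers (ideal_of T) s) f].

(** A product of a forms omits at most all the forms outside P, hence has at
    least a - nonmembers P s factors in P. *)
Lemma fold_products_power P s a f : is_ideal P ->
  f \in fold_products s a -> ideal_power P (a - nonmembers P s) f.
Proof.
move=> idP; elim: s a f => [|x s IH] [|a] f //;
  try by move=> *; exact: ideal_power0.
rewrite /= mem_cat => /orP[/IH|/mapP[g /IH Pg ->]].
  by apply: ideal_power_leq; rewrite /nonmembers; lia.
have [xP|xP] /= := boolP (x \in P).
  apply: (@ideal_power_leq _ _ _ (1 + (a - nonmembers P s))%N).
    by rewrite /nonmembers; lia.
  by apply: ideal_powerM => //; apply: ideal_power1; apply: set_mem.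
have [_ _ pM] := ideal_power_ideal P (a.+1 - (1 + nonmembers P s)).
by apply: (pM); rewrite add1n subSS.
Qed.

Lemma fold_sub_intersection s a :
  ideal_of (fold_products s a) `<=` power_intersection s a.
Proof.
move=> f Sf T _; apply: (ideal_gen_min _ _ Sf) => [|g /= Sg].
  exact: ideal_power_ideal.
by apply: fold_products_power => //; apply: ideal_of_ideal.
Qed.

(** When l :: s and a + 1 are replaced by s and a, the exponent attached to P
    drops by one if l is in P and is unchanged otherwise; division by l affects
    the order along P in the same way. *)
Lemma power_intersection_colon l s a h :
    all linear_form (l :: s) -> power_intersection (l :: s) a.+1 (l * h) ->
  power_intersection s a h.
Proof.
move=> /= /andP[/andP[l1 l0] lin_s] Jlh T Ts.
have lin_T : all (fun g => g \is 1.-homog) T.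
  by apply/allP => x /Ts/(allP lin_s)/andP[].
have [lP|lP] := boolP (l \in ideal_of T).
  (* Adjoining to T the forms of l :: s in its ideal makes l a generator. *)
  pose T' := [seq x <- l :: s | x \in ideal_of T].
  have T'T : ideal_of T' = ideal_of T.
    apply/seteqP; split=> x.
      apply: ideal_gen_min; first exact: ideal_of_ideal.
      by move=> y /=; rewrite mem_filter => /andP[/set_mem].
    apply: ideal_gen_mono => y /= Ty; rewrite mem_filter inE Ts // orbT andbT.
    by apply/mem_set/ideal_of_sub.
  have /Jlh : {subset T' <= l :: s} by move=> x; rewrite mem_filter => /andP[].
  rewrite -T'T in lP *.
  have -> : (a - nonmembers (ideal_of T') s =
             (a.+1 - nonmembers (ideal_of T') (l :: s)).-1)%N.
    by rewrite /nonmembers /= lP; lia.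
  apply: ideal_power_cancel => //.
    apply/allP => x; rewrite mem_filter inE => /andP[_].
    by case/predU1P=> [->//|/(allP lin_s)/andP[]].
  by rewrite T'T in lP; rewrite mem_filter lP mem_head.
have /Jlh : {subset T <= l :: s} by move=> x /Ts; rewrite inE orbC => ->.
rewrite {1}/nonmembers /= lP add1n subSS mulrC.
by case/(ideal_power_primary lin_T) => // /mem_set; rewrite (negbTE lP).
Qed.

End Decomposition.
Arguments linear_form {K k} f.

(** * Eliminating a linear form *)

Section Homogeneous.
Variables (K : fieldType) (k : nat).
Local Notation R := {mpoly K[k]}.
Implicit Types (f g h l : R).

Lemma pihomog_mulr d e f g :
  g \is d.-homog -> pihomog mdeg (e + d) (f * g) = pihomog mdeg e f * g.
Proof.
move=> g_d; have [n le_n] : exists n, (mmeasure mdeg f <= n)%N.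
  by exists (mmeasure mdeg f).
rewrite {1}(pihomog_partitionE le_n) mulr_suml linear_sum /=.
pose F (i : 'I_n) := if i == e :> nat then pihomog mdeg e f * g else 0.
rewrite (eq_bigr F) /F => [|i _].
  rewrite -big_mkcond /=; have [lt_en|le_ne] := ltnP e n.
    by rewrite (big_pred1 (Ordinal lt_en)).
  rewrite big_pred0 => [|i]; last by apply/eqP => ie; have := ltn_ord i; lia.
  rewrite (_ : pihomog mdeg e f = 0) ?mul0r //.
  rewrite pihomogE big_seq_cond big_pred0 // => m; apply/negP => /andP[fm /eqP].
  move=> me; have := leq_trans (mmeasure_mnm_lt mdeg fm) le_n.
  by rewrite me ltnNge le_ne.
have fg_d : pihomog mdeg i f * g \is (i + d).-homog.
  by apply: dhomogM => //; apply: pihomogP.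
case: eqP => [ie|/eqP ie]; first by rewrite -ie pihomog_dE.
by apply: pihomog_ne0 fg_d; rewrite eqn_add2r.
Qed.

Lemma homog0E f : f \is 0.-homog -> f = (f@_0)%:MP.
Proof.
move=> /dhomogP f0; apply: msize1_polyC; rewrite msizeE.
rewrite big_seq; apply/bigmax_leqP_seq => m _ /f0 m0.
by rewrite [mdeg m]m0.
Qed.

End Homogeneous.

Section Decomposition.
Variables (K : fieldType) (k : nat).
Local Notation R := {mpoly K[k]}.
Implicit Types (f g h l : R) (s S T : seq R) (P : set R).

(** The constant term of the deformation along the single form l. *)
Lemma linear_projection l : l \is 1.-homog ->
  exists2 pr : {rmorphism R -> R}, forall c, pr c%:MP = c%:MP &
    [/\ forall f, exists h, f = pr f + l * h, pr l = 0,
        forall f, f \is 1.-homog -> pr f \is 1.-homog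
      & forall f, pr (pr f) = pr f].
Proof.
move=> l1; have [|phi phiC] := @deformation K k [:: l]; first by rewrite /= l1.
move=> [phi1 phiI phil philin phi0].
have [pr prE] : exists pr : {rmorphism R -> R}, forall f, pr f = (phi f)`_0.
  exists (horner_eval 0 \o phi)%FUN => f.
  by rewrite /= /horner_eval horner_coef0.
exists pr => [c|]; first by rewrite prE phiC coefC.
split=> [f||f f1|f].
- have [_ _ IM] := ideal_of_ideal [:: l].
  suff [h Eh] : exists h, f - pr f = l * h by exists h; rewrite -Eh addrC subrK.
  have idl : is_ideal [set g | exists h, g = l * h].
    split=> [|_ _ [g ->] [h ->]|c _ [h ->]]; first by exists 0; rewrite mulr0.
      by exists (g + h); rewrite mulrDr.
    by exists (c * h); rewrite mulrCA.
  suff : ideal_of [:: l] (f - pr f).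
    apply: (ideal_gen_min idl) => g /=; rewrite inE => /eqP->.
    by exists 1; rewrite mulr1.
  rewrite -{1}[f]phi1 (horner_coef_wide _ (leqnSn _)) big_ord_recl prE.
  rewrite expr1n mulr1 [X in X - _]addrC addrK; apply: is_ideal_sum => [|i].
    exact: ideal_of_ideal.
  rewrite expr1n mulr1.
  exact: (ideal_power_sub (ideal_of_ideal _) (ltn0Sn i) (phiI f (lift ord0 i))).
- by rewrite prE phil ?mem_head // coefZ coefX mulr0.
- by rewrite prE; apply: philin.
- by rewrite !prE phi0 coefC.
Qed.

(** By homogeneity a linear form of (T) is a combination of members of T with
    scalar coefficients, so pr fixes it; but pr kills l, which is nonzero. *)
Lemma killed_notin_fixed_ideal (pr : {rmorphism R -> R}) l T :
    (forall c, pr c%:MP = c%:MP) -> {in T, forall t, pr t = t} ->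
    all (fun t => t \is 1.-homog) T -> linear_form l -> pr l = 0 ->
  ~ ideal_of T l.
Proof.
move=> prC prT /allP T1 /andP[l1 l0] prl [r [c [t [Tt El]]]].
case/eqP: l0; rewrite -prl; have := pihomog_dE l1.
rewrite {1}El linear_sum /= => <-; rewrite rmorph_sum /=.
apply: eq_bigr => i _; rewrite -[1%N]add0n pihomog_mulr; last exact: T1 (Tt i).
by rewrite rmorphM (prT _ (Tt i)) (homog0E (pihomogP _ _ _)) prC.
Qed.

(** Zero images come from the multiples of l; dropping them keeps the forms
    nonzero, and does not change the exponents because zero lies in every
    ideal. *)
Definition reduction (pr : R -> R) s := [seq x <- map pr s | x != 0].

(** The hypothesis is applied to T', the forms of l :: s whose image lies in the
    ideal (T). Then pr maps (T') into (T), and a form of s outside (T') has a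
    nonzero image outside (T), so the exponent for T is at most the one for
    T'. *)
Lemma power_intersection_reduction (pr : {rmorphism R -> R}) l s a f :
    (forall g, exists h, g = pr g + l * h) -> pr l = 0 ->
    power_intersection (l :: s) a f ->
  power_intersection (reduction pr s) a (pr f).
Proof.
move=> prD prl Jf T Ts.
pose T' := [seq x <- l :: s | pr x \in ideal_of T].
have /Jf PT' : {subset T' <= l :: s} by move=> x; rewrite mem_filter => /andP[].
have prT' g : ideal_of T' g -> ideal_of T (pr g).
  apply: ideal_gen_map; first exact: ideal_of_ideal.
  by move=> x /=; rewrite mem_filter => /andP[/set_mem].
have := ideal_power_map prT' PT'; apply: ideal_power_leq.
have T0 : 0 \in ideal_of T by apply/mem_set; have [] := ideal_of_ideal T.
apply: leq_sub2l; rewrite /nonmembers /= [l \in _]mem_set; last first.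
  by apply: ideal_of_sub; rewrite mem_filter prl T0 mem_head.
rewrite add0n /reduction count_filter count_map.
rewrite (@eq_in_count _ _ (fun x => (x \in s) && (x \notin ideal_of T'))).
  apply: sub_count => x /andP[sx xT'] /=; have prxT : pr x \notin ideal_of T.
    apply: contra xT' => prxT; apply/mem_set/ideal_of_sub.
    by rewrite mem_filter prxT inE sx orbT.
  by rewrite prxT; apply: contraNneq prxT => ->.
by move=> x /= ->.
Qed.

(** Each product of reduced forms is the image of the corresponding product of
    forms of s, to which it is congruent modulo l. *)
Lemma reduction_lift (pr : {rmorphism R -> R}) l s a f :
    (forall g, exists h, g = pr g + l * h) ->
    ideal_of (fold_products (reduction pr s) a) f ->
  exists g h, ideal_of (fold_products s a) g /\ f = g + l * h.
Proof.
move=> prD; have [I0 ID IM] := ideal_of_ideal (fold_products s a).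
apply: (@ideal_gen_min _ _ [set f | exists g h,
                       ideal_of (fold_products s a) g /\ f = g + l * h]).
  split=> [|_ _ [g [h [Ig ->]]] [g' [h' [Ig' ->]]]|c _ [g [h [Ig ->]]]].
  - by exists 0, 0; rewrite mulr0 addr0.
  - by exists (g + g'), (h + h'); rewrite mulrDr addrACA; split=> //; apply: ID.
  - by exists (c * g), (c * h); rewrite mulrDr mulrCA; split=> //; apply: IM.
move=> x /fold_products_filter; rewrite fold_products_map => /mapP[g Sg ->].
have [h Eg] := prD g; exists g, (- h); split; first exact: ideal_of_sub.
by rewrite {2}Eg mulrN addrK.
Qed.

Lemma reduction_linear (pr : R -> R) s :
    (forall f, f \is 1.-homog -> pr f \is 1.-homog) ->
  all linear_form s -> all linear_form (reduction pr s).
Proof.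
move=> pr1 /allP lin_s; apply/allP => x; rewrite mem_filter => /andP[x0].
case/mapP=> y /lin_s/andP[y1 _] Ex; rewrite /linear_form x0 andbT Ex.
exact: pr1.
Qed.

Lemma size_reduction pr s : (size (reduction pr s) <= size s)%N.
Proof. by rewrite size_filter (leq_trans (count_size _ _)) ?size_map. Qed.

Theorem fold_products_eq_intersection s a : all linear_form s ->
  ideal_of (fold_products s a) = power_intersection s a.
Proof.
have [n] := ubnP (size s); elim: n s a => // n IH s a.
case: a => [_ _|a].
  rewrite fold_products0; apply/seteqP; split=> f _.
    by move=> T _; apply: ideal_power0.
  have [_ _ IM] := ideal_of_ideal [:: (1 : R)].
  by rewrite -[f]mulr1; apply: (IM); apply: ideal_of_sub; rewrite inE.
case: s => [_ _|l s]; last rewrite ltnS => le_n lin_ls.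
  apply/seteqP; split; first exact: (@fold_sub_intersection _ _ [::] a.+1).
  move=> f /(_ [::]) /= ; rewrite subn0 => /(_ _)/ideal_power_sub; apply=> //.
  exact: ideal_of_ideal.
have /andP[/andP[l1 l0] lin_s] : linear_form l && all linear_form s by [].
have [pr prC [prD prl pr1 prK]] := linear_projection l1.
apply/seteqP; split; first exact: fold_sub_intersection.
move=> f Jf; have := power_intersection_reduction prD prl Jf.
rewrite -IH; last exact: reduction_linear; last first.
  exact: leq_ltn_trans (size_reduction _ _) le_n.
move=> /(reduction_lift prD)[g [h [Ig Eprf]]]; have [h' Ef] := prD f.
(* The class of f modulo l is that of an element g of I_a(s). *)
have {Eprf}{}Ef : f = g + l * (h + h') by rewrite Ef Eprf mulrDr addrA.
have I0 : ideal_of (fold_products s a) 0.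
  by have [] := ideal_of_ideal (fold_products s a).
have Jg : power_intersection (l :: s) a.+1 g.
  apply: fold_sub_intersection; apply/ideal_of_fold_cons.
  by exists g, 0; rewrite mulr0 addr0.
apply/ideal_of_fold_cons; exists g, (h + h'); split=> //.
rewrite IH //; apply: (power_intersection_colon lin_ls) => T Ts.
have -> : l * (h + h') = f - g by rewrite Ef addrAC subrr add0r.
apply: is_ideal_sub; [exact: ideal_power_ideal | exact: Jf | exact: Jg].
Qed.

End Decomposition.

(** * Linear syzygies *)

Section Resolutions.
Variables (K : fieldType) (k : nat).
Local Notation R := {mpoly K[k]}.

Definition homog_mx d p q (A : 'M[R]_(p, q)) : Prop :=
  forall i j, A i j \is d.-homog.

Definition generates_syzygies p n q (G : 'M[R]_(p, n)) (phi : 'M[R]_(q, p)) :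
    Prop :=
  forall v : 'rV_p, v *m G = 0 <-> exists w : 'rV_q, v = w *m phi.

(** G has a resolution of length at most N by matrices of linear forms: its
    syzygies are the row space of such a matrix, and so on. The iteration lets
    resolutions be built by induction on N, with the sizes of the matrices
    quantified one at a time. *)
Fixpoint linear_syzygies (N p n : nat) (G : 'M[R]_(p, n)) : Prop :=
  match N with
  | 0 => forall v : 'rV_p, v *m G = 0 -> v = 0
  | N'.+1 => exists q (phi : 'M[R]_(q, p)),
      [/\ homog_mx 1 phi, generates_syzygies G phi & linear_syzygies N' phi]
  end.

Lemma linear_syzygiesS N p n (G : 'M[R]_(p, n)) :
  linear_syzygies N G -> linear_syzygies N.+1 G.
Proof.
elim: N p n G => [|N IH] p n G /=.
  move=> injG; exists 0%N, 0; split=> [i j|v|v _].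
  - by rewrite mxE; apply: dhomog0.
  - split=> [/injG->|[w ->]]; last by rewrite mulmx0 mul0mx.
    by exists 0; rewrite mulmx0.
  - by rewrite [v]thinmx0.
by case=> q [phi [phi1 synG /IH]]; exists q, phi.
Qed.

Lemma linear_syzygies_leq N M p n (G : 'M[R]_(p, n)) :
  (N <= M)%N -> linear_syzygies N G -> linear_syzygies M G.
Proof.
move/subnK <-; elim: (M - N)%N => // d IH /IH.
exact: linear_syzygiesS.
Qed.

Lemma homog_mxM d e p q r (A : 'M[R]_(p, q)) (B : 'M[R]_(q, r)) :
  homog_mx d A -> homog_mx e B -> homog_mx (d + e) (A *m B).
Proof.
move=> Ad Be i j; rewrite mxE; apply: rpred_sum => l _; exact: dhomogM.
Qed.

Lemma homog_mxN d p q (A : 'M[R]_(p, q)) : homog_mx d A -> homog_mx d (- A).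
Proof. by move=> Ad i j; rewrite mxE rpredN; apply: Ad. Qed.

Lemma homog_mx0 d p q : homog_mx d (0 : 'M[R]_(p, q)).
Proof. by move=> i j; rewrite mxE; apply: dhomog0. Qed.

Lemma homog_mx_scalar p d l : l \is d.-homog -> homog_mx d (l%:M : 'M[R]_p).
Proof. by move=> ld i j; rewrite mxE; apply: rpredMn. Qed.

Lemma homog_mxZ d e p q l (A : 'M[R]_(p, q)) :
  l \is d.-homog -> homog_mx e A -> homog_mx (d + e) (l *: A).
Proof. by move=> ld Ae i j; rewrite mxE; apply: dhomogM. Qed.

Lemma homog_col_mx d p q n (A : 'M[R]_(p, n)) (B : 'M[R]_(q, n)) :
  homog_mx d A -> homog_mx d B -> homog_mx d (col_mx A B).
Proof. by move=> Ad Bd i j; rewrite mxE; case: split. Qed.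

Lemma homog_block_mx d p q n m (A : 'M[R]_(p, n)) (B : 'M[R]_(p, m))
    (C : 'M[R]_(q, n)) (D : 'M[R]_(q, m)) :
  homog_mx d A -> homog_mx d B -> homog_mx d C -> homog_mx d D ->
  homog_mx d (block_mx A B C D).
Proof.
move=> Ad Bd Cd Dd i j; rewrite mxE.
by case: (split i) => i'; rewrite mxE; case: (split j).
Qed.

(** When T factors through G at all, the homogeneous components of the
    appropriate degree of the factor already give a factorization. *)
Lemma homog_factor d e p q n (G : 'M[R]_(p, n)) (T : 'M[R]_(q, n)) :
    homog_mx d G -> homog_mx (e + d) T ->
    (forall i, exists w : 'rV_p, row i T = w *m G) ->
  exists2 X : 'M[R]_(q, p), homog_mx e X & T = X *m G.
Proof.
move=> Gd Td /choice[w Tw].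
exists (\matrix_(i, j) pihomog mdeg e (w i 0 j)) => [i j|].
  by rewrite mxE; apply: pihomogP.
apply/matrixP => i j; rewrite -(pihomog_dE (Td i j)).
have -> : T i j = (w i *m G) 0 j by rewrite -Tw mxE.
rewrite !mxE linear_sum /=; apply: eq_bigr => l _.
by rewrite pihomog_mulr // mxE.
Qed.

Lemma mul_row_block0 p q n m r (A : 'M[R]_(p, n)) (T : 'M[R]_(q, n))
    (C : 'M[R]_(q, m)) (u : 'M[R]_(r, p)) (v : 'M[R]_(r, q)) :
  row_mx u v *m block_mx A 0 T C = row_mx (u *m A + v *m T) (v *m C).
Proof. by rewrite mul_row_block mulmx0 add0r. Qed.

(** The third hypothesis says that T maps the syzygies of C into the row space of
    A, which allows lifting them to syzygies of the block matrix; the matrix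
    formed by the syzygies has again this shape, and its off-diagonal block
    inherits the hypothesis. *)
Lemma linear_syzygies_horseshoe N d p q n m (A : 'M[R]_(p, n))
    (T : 'M[R]_(q, n)) (C : 'M[R]_(q, m)) :
    homog_mx d A -> homog_mx d T ->
    (forall w : 'rV_q, w *m C = 0 -> exists u : 'rV_p, w *m T = u *m A) ->
    linear_syzygies N A -> linear_syzygies N C ->
  linear_syzygies N (block_mx A 0 T C).
Proof.
elim: N d p q n m A T C => [|N IH] d p q n m A T C Ad Td TA /=.
  move=> injA injC v; rewrite -[v]hsubmxK mul_row_block0 -(row_mx0 R 1 n m).
  case/eq_row_mx => uv /injC v0; move: uv.
  by rewrite v0 mul0mx addr0 => /injA ->; rewrite row_mx0.
move=> [p' [alpha [alpha1 synA lrA]]] [q' [gamma [gamma1 synC lrC]]].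
have gammaC0 i : row i gamma *m C = 0.
  by apply/synC; exists (delta_mx 0 i); rewrite rowE.
have [|||X X1 EX] := @homog_factor d 1 _ _ _ A (gamma *m T) => //.
- exact: homog_mxM.
- by move=> i; rewrite row_mul; apply: TA.
exists (p' + q')%N, (block_mx alpha 0 (- X) gamma); split.
- by apply: homog_block_mx => //; [apply: homog_mx0 | apply: homog_mxN].
- move=> v; rewrite -[v]hsubmxK mul_row_block0 -(row_mx0 R 1 n m).
  split=> [/eq_row_mx[uv /synC[w Ew]]|[w]].
    rewrite Ew in uv *; move: uv; rewrite -mulmxA EX mulmxA -mulmxDl.
    case/synA=> u Eu; exists (row_mx u w).
    by rewrite mul_row_block0 mulmxN -Eu addrK.
  rewrite -[w]hsubmxK mul_row_block0 => /eq_row_mx[-> ->].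
  rewrite mulmxDl -!mulmxA EX mulNmx mulmxN subrK; congr row_mx.
    by rewrite mulmxA; apply/synA; exists (lsubmx w).
  by rewrite mulmxA; apply/synC; exists (rsubmx w).
- apply: (IH 1%N) => // [|w wg0]; first exact: homog_mxN.
  have /synA[u Eu] : w *m X *m A = 0 by rewrite -mulmxA -EX mulmxA wg0 mul0mx.
  by exists (- u); rewrite mulmxN Eu mulNmx.
Qed.

Lemma scale_mx_eq0 l p q (A : 'M[R]_(p, q)) : l != 0 -> l *: A = 0 -> A = 0.
Proof.
move=> l0 /matrixP lA; apply/matrixP => i j; move/eqP: (lA i j).
by rewrite !mxE mulf_eq0 (negbTE l0) => /eqP.
Qed.

(** When l is regular modulo the row space of G, the rows of col_mx phi l%:M
    generate the syzygies of G modulo l. Their own syzygies form a block matrix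
    with off-diagonal block - l%:M, whose diagonal blocks continue the resolution
    of G: this is the mapping cone of multiplication by l. *)
Lemma linear_syzygies_cone N l p q n (G : 'M[R]_(p, n)) (phi : 'M[R]_(q, p)) :
    l \is 1.-homog -> l != 0 -> homog_mx 1 phi -> generates_syzygies G phi ->
    linear_syzygies N phi ->
  linear_syzygies N.+1 (col_mx phi l%:M).
Proof.
move=> l1 l0 phi1 synG lr_phi.
have [r [psi [psi1 syn_phi lr_psi]]] := linear_syzygiesS lr_phi.
have phiG0 (w : 'rV_q) : w *m phi *m G = 0 by apply/synG; exists w.
exists (r + q)%N, (block_mx psi 0 (- l%:M) phi); split.
- apply: homog_block_mx => //; first exact: homog_mx0.
  by apply: homog_mxN; apply: homog_mx_scalar.
- move=> v; rewrite -[v]hsubmxK mul_row_col mul_mx_scalar.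
  split=> [uv0|[w]]; last first.
    rewrite -[w]hsubmxK mul_row_block0 => /eq_row_mx[-> ->].
    rewrite mulmxN mul_mx_scalar mulmxBl -scalemxAl subrK.
    by apply/syn_phi; exists (lsubmx w).
  have /synG[w Ew] : rsubmx v *m G = 0.
    apply: (scale_mx_eq0 l0); rewrite scalemxAl.
    by rewrite -[LHS]add0r -[in LHS](phiG0 (lsubmx v)) -mulmxDl uv0 mul0mx.
  move: uv0; rewrite Ew scalemxAl -mulmxDl => /syn_phi[u Eu].
  exists (row_mx u w); rewrite mul_row_block0 -Eu mulmxN mul_mx_scalar.
  by rewrite addrK.
- apply: linear_syzygies_horseshoe lr_psi lr_phi => //.
    by apply: homog_mxN; apply: homog_mx_scalar.
  move=> w w0; have /syn_phi[u ->] : w *m (- l%:M) *m phi = 0.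
    by rewrite mulmxN mul_mx_scalar mulNmx -scalemxAl w0 scaler0 oppr0.
  by exists u.
Qed.

End Resolutions.

(** * Linear resolution of an extension *)

Section Extension.
Variables (K : fieldType) (k : nat).
Local Notation R := {mpoly K[k]}.
Implicit Types (f g h l : R) (I A C : set R).

Definition linearly_resolved d I : Prop :=
  exists N p (G : 'cV[R]_p),
    [/\ homog_mx d G, forall f, I f <-> exists v : 'rV_p, f = (v *m G) 0 0
      & linear_syzygies N G].

Lemma mx11P (A B : 'M[R]_1) : A 0 0 = B 0 0 -> A = B.
Proof. by move=> AB; rewrite [A]mx11_scalar AB -mx11_scalar. Qed.

Lemma ideal_row_comb I p (v : 'rV[R]_p) (G : 'cV[R]_p) :
  is_ideal I -> (forall i, I (G i 0)) -> I ((v *m G) 0 0).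
Proof.
move=> idI IG; rewrite mxE; apply: is_ideal_sum => // i.
by case: idI => _ _; apply.
Qed.

(** The matrix [GC] lifts to I, modulo l, the generators [GC'] of C, and
    col_mx (l *: GA) GC generates I. The rows v with v *m GC divisible by l are
    the syzygies of [GC'] modulo l, resolved by [linear_syzygies_cone]; for them
    v *m GC is in l A, because (I : l) = A, and this is the lifting hypothesis
    of [linear_syzygies_horseshoe]. *)
Lemma linearly_resolved_extension d l I A C :
    l \is 1.-homog -> l != 0 -> is_ideal I -> is_ideal C ->
    (forall f, I f -> I (pihomog mdeg d.+1 f)) ->
    (forall h, I (l * h) <-> A h) -> (forall h, C (l * h) -> C h) ->
    (forall f, I f -> exists c h, C c /\ f = c + l * h) ->
    (forall c, C c -> exists f h, I f /\ c = f + l * h) ->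
    linearly_resolved d A -> linearly_resolved d.+1 C ->
  linearly_resolved d.+1 I.
Proof.
move=> l1 l0 idI idC homI colon nzd IC CI.
move=> [NA [p [GA [GAd GA_A /linear_syzygiesS lrA]]]].
move=> [NC [q [GC' [GCd GC_C /linear_syzygiesS lrC]]]].
have [_ ID IM] := idI.
have {lrA}[p' [alpha [alpha1 synA lrA]]] := lrA.
have {lrC}[q' [gamma [gamma1 synC lrC]]] := lrC.
(* Lift the generators of C to I, keeping only components of degree d + 1. *)
have {CI}/choice[F /choice[H FH]] i : exists f, exists h,
    [/\ I f, f \is d.+1.-homog & GC' i 0 = f + l * h].
  have /CI[f [h [If Ei]]] : C (GC' i 0).
    by apply/GC_C; exists (delta_mx 0 i); rewrite -rowE mxE.
  exists (pihomog mdeg d.+1 f), (pihomog mdeg d h); split.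
  - exact: homI.
  - exact: pihomogP.
  - rewrite -(pihomog_dE (GCd i 0)) Ei pihomogD; congr (_ + _).
    by rewrite mulrC -addn1 pihomog_mulr // mulrC.
pose GC := \col_i F i; pose Hc := \col_i H i.
have EGC : GC' = GC + l *: Hc.
  by apply/colP => i; rewrite !mxE; case: (FH i).
have IGC i : I (GC i 0) by rewrite mxE; case: (FH i).
have GCh : homog_mx d.+1 GC by move=> i j; rewrite mxE; case: (FH i).
have lGAh : homog_mx d.+1 (l *: GA) by rewrite -add1n; apply: homog_mxZ.
have IlGA i : I ((l *: GA) i 0).
  rewrite mxE; apply/colon/GA_A; exists (delta_mx 0 i).
  by rewrite -rowE mxE.
(* As (I : l) = A, an element of I divisible by l is in the ideal l A. *)
have factorA (w : 'rV_q) t : w *m GC = l *: t ->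
    exists u : 'rV_p, w *m GC = u *m (l *: GA).
  move=> wt; have /colon/GA_A[u Eu] : I (l * t 0 0).
    have -> : l * t 0 0 = (w *m GC) 0 0 by rewrite wt mxE.
    exact: ideal_row_comb.
  exists u; rewrite wt -scalemxAr; congr (_ *: _); exact: mx11P.
pose M := col_mx gamma l%:M.
have M1 : homog_mx 1 M.
  by apply: homog_col_mx => //; apply: homog_mx_scalar.
have gammaGC0 (w : 'rV_q') : w *m gamma *m GC' = 0.
  by apply/synC; exists w.
(* If v *m GC = l t, then v *m GC' = l (t + v *m Hc) and t + v *m Hc is in C
   because l is regular modulo C; subtracting l times its coordinates from v
   leaves a syzygy of GC'. *)
have modM (v : 'rV_q) : (exists t, v *m GC = l *: t) <-> exists w, v = w *m M.
  split=> [[t vt]|[w ->]].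
    have EvG : v *m GC' = l *: (t + v *m Hc).
      by rewrite EGC mulmxDr vt -scalemxAr scalerDr.
    have /nzd/GC_C[s Es] : C (l * (t + v *m Hc) 0 0).
      by apply/GC_C; exists v; rewrite EvG [in RHS]mxE.
    have /synC[w Ew] : (v - l *: s) *m GC' = 0.
      by rewrite mulmxBl EvG -scalemxAl (mx11P Es) subrr.
    exists (row_mx w s).
    by rewrite mul_row_col -Ew mul_mx_scalar subrK.
  rewrite -[w]hsubmxK mul_row_col mulmxDl.
  have := gammaGC0 (lsubmx w).
  rewrite EGC mulmxDr => /(canRL (addrK _)) ->.
  rewrite mul_mx_scalar -scalemxAl -scalemxAr sub0r -scalerN -scalerDr.
  by eexists.
have lrM : linear_syzygies NC.+1 M :=
  linear_syzygies_cone l1 l0 gamma1 synC lrC.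
have [||i|X X1 EX] := @homog_factor _ _ d.+1 1 _ _ _ (l *: GA) (M *m GC).
- by [].
- exact: homog_mxM.
- have /modM[t Et] : exists w, row i M = w *m M.
    by exists (delta_mx 0 i); rewrite -rowE.
  by rewrite row_mul; apply: factorA Et.
exists (maxn NA NC.+1).+1, (p + q)%N, (col_mx (l *: GA) GC); split.
- exact: homog_col_mx.
- move=> f; split=> [If|[v ->]]; last first.
    apply: ideal_row_comb => // i.
    by rewrite mxE; case: split => j; [apply: IlGA | apply: IGC].
  have [c [h [/GC_C[v Ev] Ef]]] := IC _ If.
  have fE : f - (v *m GC) 0 0 = l * (h + (v *m Hc) 0 0).
    rewrite Ef Ev EGC mulmxDr -scalemxAr.
    rewrite [fun_of_matrix (_ + _) 0 0]mxE [fun_of_matrix (l *: _) 0 0]mxE.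
    rewrite mulrDr.
    by rewrite [LHS]addrAC [X in X + _]addrAC subrr add0r addrC.
  have /colon/GA_A[u Eu] : I (l * (h + (v *m Hc) 0 0)).
    by rewrite -fE; apply: is_ideal_sub => //; apply: ideal_row_comb.
  exists (row_mx u v); rewrite mul_row_col -scalemxAr.
  rewrite [fun_of_matrix (_ + _) 0 0]mxE [fun_of_matrix (l *: _) 0 0]mxE.
  by rewrite -Eu -fE subrK.
- exists (p' + (q' + q))%N, (block_mx alpha 0 (- X) M); split.
  + by apply: homog_block_mx => //; [apply: homog_mx0 | apply: homog_mxN].
  + move=> v; rewrite -[v]hsubmxK mul_row_col; split=> [|[w]].
      move=> /eqP; rewrite addrC addr_eq0 => /eqP uv.
      have /modM[w Ew] : exists t, rsubmx v *m GC = l *: t.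
        by exists (- (lsubmx v *m GA)); rewrite uv -scalemxAr scalerN.
      move: uv; rewrite Ew -mulmxA EX => /eqP; rewrite -addr_eq0 mulmxA.
      rewrite -mulmxDl -scalemxAr => /eqP/(scale_mx_eq0 l0)/synA[u Eu].
      exists (row_mx u w); rewrite mul_row_block0 -Eu mulmxN.
      by rewrite addrAC addrC subrr addr0.
    rewrite -[w]hsubmxK mul_row_block0 => /eq_row_mx[-> ->].
    rewrite mulmxDl -[X in _ + X]mulmxA EX mulmxN mulNmx.
    rewrite [X in _ + X]mulmxA subrK -scalemxAr.
    suff -> : lsubmx w *m alpha *m GA = 0 by rewrite scaler0.
    by apply/synA; exists (lsubmx w).
  + apply: (@linear_syzygies_horseshoe _ _ _ 1) => //.
    * exact: homog_mxN.
    * move=> w wM0; apply/synA; apply: (scale_mx_eq0 l0).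
      by rewrite scalemxAr mulmxN mulNmx -mulmxA -EX mulmxA wM0 mul0mx oppr0.
    * exact: linear_syzygies_leq (leq_maxl _ _) lrA.
    * exact: linear_syzygies_leq (leq_maxr _ _) lrM.
Qed.

End Extension.

(** * Linear resolution and primary decomposition for fold products *)

Section FoldProducts.
Variables (K : fieldType) (k : nat).
Local Notation R := {mpoly K[k]}.
Implicit Types (f g h l : R) (s S T : seq R).

Lemma pihomog_ideal_of d S f : {in S, forall g, g \is d.-homog} ->
  ideal_of S f -> ideal_of S (pihomog mdeg d f).
Proof.
move=> Sd [r [c [g [Sg ->]]]]; rewrite linear_sum /=.
have [_ _ IM] := ideal_of_ideal S.
apply: is_ideal_sum => [|i]; first exact: ideal_of_ideal.
rewrite -[d]add0n pihomog_mulr; last exact: Sd (Sg i).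
by apply: IM; apply: ideal_of_sub; apply: Sg.
Qed.

(** The hypotheses of [linearly_resolved_extension] translate into statements on
    I_a by the equality of I_a and J_a, which gives both the colon ideal and the
    regularity of l modulo I_a(t). *)
Theorem fold_products_linearly_resolved s d : all linear_form s ->
  linearly_resolved d (ideal_of (fold_products s d)).
Proof.
have [n] := ubnP (size s); elim: n s d => // n IH s d.
case: d => [_ _|d].
  exists 0%N, 1%N, 1%:M; split=> [i j|f|v]; last by rewrite mulmx1.
    by apply: homog_mx_scalar; apply: dhomog1.
  rewrite fold_products0; split=> _.
    by exists f%:M; rewrite mulmx1 mxE.
  have [_ _ IM] := ideal_of_ideal [:: (1 : R)].
  by rewrite -[f]mulr1; apply: (IM); apply: ideal_of_sub; rewrite inE.
case: s => [_ _|l s]; last rewrite ltnS => le_n lin_ls.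
  exists 0%N, 0%N, 0; split=> [i j|f|v _]; [by case: i| |exact: thinmx0].
  have id0 : is_ideal [set (0 : R)].
    split=> [//|_ _ -> ->|c _ ->] /=; first by rewrite addr0.
    by rewrite mulr0.
  split=> [If|[v ->]].
    by exists 0; rewrite mulmx0 mxE; apply: (ideal_gen_min id0 _ If).
  by rewrite mulmx0 mxE; have [] := ideal_of_ideal (@fold_products R [::] d.+1).
have /andP[/andP[l1 l0] lin_s] : linear_form l && all linear_form s by [].
have [pr prC [prD prl pr1 prK]] := linear_projection l1.
have lin_t := reduction_linear pr1 lin_s.
have I0 S : ideal_of S 0 by have [] := ideal_of_ideal S.
apply: (@linearly_resolved_extension _ _ _ l _ (ideal_of (fold_products s d))
          (ideal_of (fold_products (reduction pr s) d.+1))) => //.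
- exact: ideal_of_ideal.
- exact: ideal_of_ideal.
- by move=> f; apply: pihomog_ideal_of; apply: fold_products_homog.
- move=> h; split=> [|Ih].
    rewrite !fold_products_eq_intersection //.
    exact: power_intersection_colon.
  by apply/ideal_of_fold_cons; exists 0, h; rewrite add0r.
- move=> h; rewrite fold_products_eq_intersection // => Jlh T Tt.
  have T1 : all (fun t => t \is 1.-homog) T.
    by apply/allP => t /Tt/(allP lin_t)/andP[].
  have := Jlh T Tt; rewrite mulrC => /(ideal_power_primary T1)[//|].
  move=> /(killed_notin_fixed_ideal prC) []//; last exact/andP.
  move=> t /Tt; rewrite mem_filter => /andP[_ /mapP[x _ ->]]; exact: prK.
- move=> f; rewrite !fold_products_eq_intersection // => Jf.
  have [h Ef] := prD f; exists (pr f), h; split=> //.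
  exact: power_intersection_reduction Jf.
- move=> c /(reduction_lift prD)[g [h [Ig Ec]]]; exists g, h; split=> //.
  by apply/ideal_of_fold_cons; exists g, 0; rewrite mulr0 addr0.
- exact: IH.
- by apply: IH => //; apply: leq_ltn_trans (size_reduction _ _) le_n.
Qed.

(** As rk is quantified after p, the first size is tied to p by an equation,
    along which G is cast. *)
Lemma resolution_sequence N p n (G : 'M[R]_(p, n)) : linear_syzygies N G ->
  exists rk : nat -> nat, exists phi : forall j, 'M[R]_(rk j.+1, rk j),
  exists E : rk 0%N = p,
    [/\ exists b, rk b.+1 = 0%N, forall j, homog_mx 1 (phi j),
        generates_syzygies (castmx (esym E, erefl n) G) (phi 0%N)
      & forall j, generates_syzygies (phi j) (phi j.+1)].
Proof.
elim: N p n G => [|N IH] p n G.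
  move=> injG; exists (fun j => if j is 0%N then p else 0%N), (fun=> 0), erefl.
  split=> [||v|j v]; [by exists 0%N | by move=> j; apply: homog_mx0 | |].
    rewrite castmx_id; split=> [/injG->|[w ->]].
      by exists 0; rewrite mulmx0.
    by rewrite mulmx0 mul0mx.
  split=> _; first by exists 0; rewrite [LHS]thinmx0 mulmx0.
  by rewrite mulmx0.
move=> [q [psi [psi1 synG /IH[rk [phi [E]]]]]].
subst q; rewrite castmx_id => -[[b rkb] phi1 syn0 syn].
pose rk' j := if j is j'.+1 then rk j' else p.
exists rk', (fun j => match j return 'M[R]_(rk' j.+1, rk' j) with
                     0%N => psi | j'.+1 => phi j' end), erefl.
split; [by exists b.+1 | by case | by rewrite castmx_id | by case].
Qed.

(** Cutting the resolution at its first vanishing rank makes all the earlier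
    ranks positive. *)
Lemma linearly_resolved_has_resolution d (I : set R) :
  linearly_resolved d I -> has_linear_resolution I.
Proof.
move=> [N [p [G [Gd GI]]]] /resolution_sequence[rk [phi [E]]]; subst p.
rewrite castmx_id => -[[b0 rkb0] phi1 syn0 syn].
have [rk0|rk0] := posnP (rk 0%N).
  left; apply/seteqP; split=> [f /GI[v ->]|_ ->]; last first.
    by apply/GI; exists 0; rewrite mul0mx mxE.
  by rewrite mxE big1 // => i; have := ltn_ord i; rewrite {2}rk0.
right; have ex_b : exists b, rk b.+1 == 0%N by exists b0; apply/eqP.
have [b /eqP rkb min_b] := ex_minnP ex_b.
exists d, b, rk, G, phi; split=> //.
- case=> [_|j jb]; first exact: rk0.
  by rewrite lt0n; apply: contraL jb => /min_b; rewrite -leqNgt.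
- by move=> j _; apply: phi1.
- move=> f; rewrite GI; split=> -[v Ev]; exists v.
    by apply: mx11P; rewrite mxE.
  by rewrite -Ev mxE.
- by move=> j _; apply: syn.
Qed.

(** Ideals generated by linear forms are prime, by [ideal_of_prime]. *)
Lemma GammaP s P : all linear_form s ->
  Gamma s P <-> exists2 T, {subset T <= s} & P = ideal_of T.
Proof.
move=> lin_s; split=> [[_ [S Ss ->]]|[T Ts ->]]; last first.
  split; last by exists [set` T] => // x /Ts.
  by apply: ideal_of_prime; apply/allP => x /Ts/(allP lin_s)/andP[].
exists [seq x <- s | x \in S] => [x|]; first by rewrite mem_filter => /andP[].
congr ideal_gen; apply/seteqP; split=> x /=; rewrite mem_filter.
  by move=> Sx; rewrite mem_set //; apply: Ss.
by case/andP => /set_mem.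
Qed.

Lemma finite_Gamma s : finite_set (Gamma s).
Proof.
pose F (b : (size s).-tuple bool) : set R := ideal_of (mask b s).
apply: (@sub_finite_set _ _ (F @` setT)); last first.
  by apply: finite_image; apply: finite_finset.
move=> P [_ [S Ss ->]]; exists (map_tuple (mem S) (in_tuple s)) => //.
rewrite /F /= -filter_mask; congr ideal_gen; apply/seteqP.
split=> x /=; rewrite mem_filter; first by case/andP => /set_mem.
by move=> Sx; rewrite [mem S x]mem_set //; apply: Ss.
Qed.

Lemma fold_products_primary_decomposition s a : all linear_form s ->
  primary_decomposition (ideal_of (fold_products s a)) (Gamma s)
    (fun P => ideal_power P (a + nu s P - size s)%N).
Proof.
move=> lin_s; split.
- exact: finite_Gamma.
- move=> P /(GammaP _ lin_s)[T Ts ->].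
  have T1 : all (fun t => t \is 1.-homog) T.
    by apply/allP => x /Ts/(allP lin_s)/andP[].
  set e := (_ - _)%N; have [->|e0] := posnP e.
    by left; apply/seteqP; split=> // f _; apply: ideal_power0.
  by right; split; [apply: ideal_power_is_primary | apply: radical_power].
have expE P : (a + nu s P - size s = a - nonmembers P s)%N.
  by rewrite /nu -(count_predC (mem P) s) addnC subnDl.
rewrite fold_products_eq_intersection //.
apply/seteqP; split=> f Jf => [P /(GammaP _ lin_s)[T Ts ->] /=|T Ts].
  by rewrite expE; apply: Jf.
by rewrite -expE; apply: Jf; apply/GammaP => //; exists T.
Qed.

End FoldProducts.

Theorem theorem2p2 (K : fieldType) (k s : nat)
    (ell : 'I_s -> {mpoly K[k]}) (m : 'I_s -> nat) (a : nat) :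
  [pchar K] =i pred0 ->
  (forall i, ell i \is 1.-homog) ->
  (forall i, ell i != 0) ->
  (forall i, (1 <= m i)%N) ->
  (forall i j, i != j -> rcoprime (ell i) (ell j)) ->
  let n := (\sum_(i < s) m i)%N in
  let Sigma := collection m ell in
  (1 <= a <= n)%N ->
  has_linear_resolution (fold_products_ideal a Sigma) /\
  primary_decomposition (fold_products_ideal a Sigma) (Gamma Sigma)
    (fun P => ideal_power P (a + nu Sigma P - n)%N).
Proof.
move=> _ ell1 ell0 _ _ n Sigma _.
have lin_Sigma : all linear_form Sigma.
  apply/allP => x /flattenP[_ /mapP[i _ ->]].
  rewrite mem_nseq => /andP[_ /eqP->].
  by rewrite /linear_form ell1 ell0.
have size_Sigma : size Sigma = n.
  rewrite size_flatten /shape -map_comp sumnE big_map big_enum /=.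
  by apply: eq_bigr => i _; rewrite size_nseq.
rewrite fold_products_idealE -size_Sigma; split.
  apply: (@linearly_resolved_has_resolution _ _ a).
  exact: fold_products_linearly_resolved.
exact: fold_products_primary_decomposition.
Qed.
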